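(* Let $0<a\le1$ and let $b$ satisfy $\max\{2a,1\}\le b\le a+1$. Then there exists a compact set $X\subset[0,1]$ with $\overline{\dim}_B(X)=a$ and $\overline{\dim}_{GB}(X)=b$.
   Context: For $\delta>0$ and $F\subset\mathbb{R}^d$, $N_\delta(F)$ is the number of cubes of the standard $\delta$-grid in $\mathbb{R}^d$ that intersect $F$, and $\overline{\dim}_B(F)=\limsup_{\delta\to0}\frac{\log N_\delta(F)}{-\log\delta}$. $C_u(X)$ is the set of uniformly continuous real functions on $X$, $\mathrm{graph}(f)=\{(x,f(x)):x\in X\}$, and $\overline{\dim}_{GB}(X)=\sup_{f\in C_u(X)}\overline{\dim}_B(\mathrm{graph}(f))$. *)

(* Defs.v *)
From HB Require Import structures.
From mathcomp Require Import finmap.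
From mathcomp Require Import all_boot all_order all_algebra.
From mathcomp Require Import all_classical all_reals all_analysis.
Set Implicit Arguments. Unset Strict Implicit. Unset Printing Implicit Defensive.
Import Order.TTheory GRing.Theory Num.Theory.
Local Open Scope classical_set_scope.
Local Open Scope ring_scope.

Definition ecount {T : choiceType} (R : realType) (S : set T) : \bar R :=
  if pselect (finite_set S) then ((#|` fset_set S |)%:R)%:E else +oo%E.

(* Standard delta-grid in R^1: cubes [k d, (k+1) d), k in Z. *)
Definition gridN1 (R : realType) (F : set R) (d : R) : \bar R :=
  ecount R [set k : int | exists2 x, F x & Num.floor (x / d) = k].

(* Standard delta-grid in R^2: squares [k d,(k+1) d) x [l d,(l+1) d). *)
Definition gridN2 (R : realType) (F : set (R * R)) (d : R) : \bar R :=
  ecount R [set kl : int * int | exists2 p, F p &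
     (Num.floor (p.1 / d), Num.floor (p.2 / d)) = kl].

Definition box_ratio (R : realType) (N : \bar R) (d : R) : \bar R :=
  match N with
  | EFin n => (ln n / (- ln d))%:E
  | _ => +oo%E
  end.

Definition limsup0 (R : realType) (g : R -> \bar R) : \bar R :=
  ereal_inf [set s | exists2 eta : R, 0 < eta &
     s = ereal_sup [set g d | d in [set d : R | 0 < d < eta]]].

Definition upper_box_dim1 (R : realType) (F : set R) : \bar R :=
  limsup0 (fun d => box_ratio (gridN1 F d) d).

Definition upper_box_dim2 (R : realType) (F : set (R * R)) : \bar R :=
  limsup0 (fun d => box_ratio (gridN2 F d) d).

(* f : R -> R is uniformly continuous on X (only values on X matter) *)
Definition unif_cont_on (R : realType) (X : set R) (f : R -> R) : Prop :=
  forall e : R, 0 < e -> exists2 del : R, 0 < del &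
    forall x y, X x -> X y -> `|x - y| < del -> `|f x - f y| < e.

Definition graph_on (R : realType) (X : set R) (f : R -> R) : set (R * R) :=
  [set (x, f x) | x in X].

Definition upper_graph_box_dim (R : realType) (X : set R) : \bar R :=
  ereal_sup [set upper_box_dim2 (graph_on X f) | f in unif_cont_on X].

(* Main.v *)
(** Put [e_m = 4^-(m+1)!] and [d_m = e_(m+1) = e_m^(m+2)], so that [ln e_m] is
    negligible against [ln d_m].  The set is [0] together with finite levels;
    level [m] starts at [e_m] and consists of about [e_m d_m^(1-b)] clusters with
    spacing [d_m], each made of [e_m / d_m] points with spacing [d_m^(b/a)].  It
    has [d_m^(-b)] points up to powers of [e_m]; they fit since [2a <= b].

    Seen at scale [d_m^(b/a)] all these points are separate, which gives dimension
    [a]; sending the [j]-th point of every cluster to [j d_m] defines a uniformly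
    continuous function whose graph at scale [d_m] separates them too, which gives
    dimension [b].  Conversely, at a scale [r] let [n] be minimal with [d_n < r].
    Levels [m < n] have at most [2 d_m^(-b) <= 2 r^(-b)] points, level [n] has
    width [O(d_n^(2-b))], hence meets [O(r^(1-b))] columns, each contributing
    [O(1/r)] squares, and all later levels lie in [0, 3 d_n].  Finally
    [n = O(r^(-e))] for every [e > 0], so summing over the levels is harmless. *)

Require Import Defs.
From HB Require Import structures.
From mathcomp Require Import finmap.
From mathcomp Require Import all_boot all_order all_algebra.
From mathcomp Require Import all_classical all_reals all_analysis.
From mathcomp Require Import lra ring zify.
Set Implicit Arguments. Unset Strict Implicit. Unset Printing Implicit Defensive.
Import Order.TTheory GRing.Theory Num.Theory numFieldNormedType.Exports.
Local Open Scope classical_set_scope.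
Local Open Scope ring_scope.

(** * Counting and upper box dimension *)

(** Counting by a list, repetitions allowed, against a real bound: such bounds add over unions and
    multiply over products without any computation of cardinals. *)
Definition covered (R : realType) (T : choiceType) (S : set T) (M : R) : Prop :=
  exists s : seq T, (forall x, S x -> x \in s) /\ (size s)%:R <= M.

Lemma covered_sub (R : realType) (T : choiceType) (S S' : set T) (M M' : R) :
  covered S M -> S' `<=` S -> M <= M' -> covered S' M'.
Proof.
move=> [s [Ss sM]] sub MM'; exists s; split; last exact: le_trans MM'.
by move=> x /sub /Ss.
Qed.

Lemma covered_setU (R : realType) (T : choiceType) (A B : set T) (M M' : R) :
  covered A M -> covered B M' -> covered (A `|` B) (M + M').
Proof.
move=> [s [As sM]] [t [Bt tM]]; exists (s ++ t); split; last first.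
  by rewrite size_cat natrD lerD.
by move=> x [/As|/Bt] xin; rewrite mem_cat xin ?orbT.
Qed.

Lemma covered_bigcup (R : realType) (T : choiceType) (n : nat)
    (A : nat -> set T) (M : R) :
  (forall i, (i < n)%N -> covered (A i) M) ->
  covered (\bigcup_(i in `I_n) A i) (n%:R * M).
Proof.
elim: n => [|n IH] AM.
  by exists [::]; split; [move=> x [] | rewrite mul0r].
have cn := covered_setU (IH (fun i Hi => AM i (ltnW Hi))) (AM n (ltnSn n)).
apply: (covered_sub cn); last by rewrite -natr1 mulrDl mul1r.
move=> x [i /= ilt Aix]; move: ilt; rewrite ltnS leq_eqVlt => /orP[/eqP <-|ilt].
  by right.
by left; exists i.
Qed.

Lemma covered_setX (R : realType) (T U : choiceType) (A : set T) (B : set U)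
    (M M' : R) :
  covered A M -> covered B M' -> covered (A `*` B) (M * M').
Proof.
move=> [s [As sM]] [t [Bt tM]]; exists [seq (x, y) | x <- s, y <- t]; split.
  by move=> [x y] [/= /As xs /Bt yt]; apply/allpairsP; exists (x, y).
by rewrite size_allpairs natrM ler_pM.
Qed.

(** The floors lie in the block of consecutive integers from [fu] to [fv], and [fv <= v / r] while
    [fu > u / r - 1]. *)
Lemma covered_floor_itv (R : realType) (u v r : R) : 0 < r -> u <= v ->
  covered [set k : int | exists2 x, u <= x <= v & Num.floor (x / r) = k]
    ((v - u) / r + 2).
Proof.
move=> r0 uv; set fu := Num.floor (u / r); set fv := Num.floor (v / r).
have fuv : fu <= fv by apply: le_floor; rewrite ler_pM2r ?invr_gt0.
have /andP[_ ltu] := floor_itv (u / r); have /andP[lev _] := floor_itv (v / r).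
have [n nE] : exists n : nat, fv = fu + n%:Z.
  by exists `|fv - fu|%N; lia.
exists [seq fu + i%:Z | i <- iota 0 n.+1]; split; last first.
  rewrite size_map size_iota -natr1 mulrBl.
  have : fv%:~R = fu%:~R + n%:R :> R by rewrite nE intrD.
  by move: lev ltu; rewrite -/fv -/fu intrD => *; lra.
move=> k [x /andP[ux xv] <-].
have fux : fu <= Num.floor (x / r) by apply: le_floor; rewrite ler_pM2r ?invr_gt0.
have fxv : Num.floor (x / r) <= fv by apply: le_floor; rewrite ler_pM2r ?invr_gt0.
apply/mapP; exists `|Num.floor (x / r) - fu|%N; last first.
  by move: fux; lia.
by rewrite mem_iota; move: fux fxv; rewrite nE; lia.
Qed.

Lemma covered_finite (R : realType) (T : choiceType) (S : set T) (M : R) :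
  covered S M -> finite_set S.
Proof. by move=> [s [Ss _]]; exact: (sub_finite_set Ss (finite_seq s)). Qed.

Lemma ecount_le_covered (R : realType) (T : choiceType) (S : set T) (M : R) :
  covered S M -> exists2 n : nat, ecount R S = n%:R%:E & n%:R <= M.
Proof.
move=> cov; have finS := covered_finite cov; case: cov => s [Ss sM].
rewrite /ecount; case: (pselect (finite_set S)) => [h|nh]; last by case: nh.
exists #|` fset_set S| => //.
apply: le_trans sM; rewrite ler_nat.
apply: uniq_leq_size; first exact: fset_uniq.
by move=> x; rewrite in_fset_set// inE => /Ss.
Qed.

Lemma box_ratio_le (R : realType) (T : choiceType) (S : set T) (M d : R) :
  0 < d < 1 -> 1 <= M -> covered S M ->
  (box_ratio (ecount R S) d <= (ln M / (- ln d))%:E)%E.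
Proof.
move=> /andP[d0 d1] M1 /ecount_le_covered[n -> nM]; rewrite /box_ratio lee_fin.
have ld : ln d < 0 by apply: ln_lt0; rewrite d0.
rewrite ler_pM2r ?invr_gt0 ?oppr_gt0//.
(* For an empty count [ln 0] takes the default value [0], which [1 <= M] keeps below [ln M]. *)
case: n nM => [|n] nM; first by rewrite ln0// ln_ge0.
by rewrite ler_ln// posrE// (lt_le_trans _ M1).
Qed.

Lemma box_ratio_ge (R : realType) (T : choiceType) (S : set T) (s : seq T)
    (M d : R) :
  0 < d < 1 -> 0 < M -> uniq s -> (forall x, x \in s -> S x) ->
  M <= (size s)%:R -> ((ln M / (- ln d))%:E <= box_ratio (ecount R S) d)%E.
Proof.
move=> /andP[d0 d1] M0 us sS Ms; rewrite /ecount.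
case: (pselect (finite_set S)) => [finS|nfin]; last exact: leey.
have ld : ln d < 0 by apply: ln_lt0; rewrite d0.
rewrite lee_fin ler_pM2r ?invr_gt0 ?oppr_gt0//.
have {}Ms : M <= #|` fset_set S|%:R.
  apply: le_trans Ms _; rewrite ler_nat; apply: uniq_leq_size => // x /sS Sx.
  by rewrite in_fset_set// inE.
by rewrite ler_ln// posrE// (lt_le_trans M0).
Qed.

(** Half of the allowed excess [e] is spent on the exponent, the other half absorbs the constant [C]
    once [r] is small. *)
Lemma limsup0_le (R : realType) (T : choiceType) (S : R -> set T) (t : R) :
  0 <= t ->
  (forall e : R, 0 < e -> exists C eta : R, 0 < eta /\ forall r : R, 0 < r < eta ->
     covered (S r) (C * expR (- (t + e) * ln r))) ->
  (limsup0 (fun d => box_ratio (ecount R (S d)) d) <= t%:E)%E.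
Proof.
move=> t0 H; apply/lee_addgt0Pr => e e0.
have e20 : 0 < e / 2 by rewrite divr_gt0.
have [C [eta [eta0 HC]]] := H _ e20.
pose D := Num.max C 1; have D1 : 1 <= D by rewrite le_max lexx orbT.
(* Below the last bound [ln D <= (e / 2) * - ln r], so the factor [D] costs at most [e / 2] in the
   ratio. *)
pose eta' := Num.min (Num.min eta 1) (expR (- (2 * ln D / e))).
apply: ge_ereal_inf; exists (ereal_sup
  [set box_ratio (ecount R (S d)) d | d in [set d | 0 < d < eta']]).
  by exists eta' => //; rewrite !lt_min eta0 ltr01 expR_gt0.
apply: ge_ereal_sup => _ [r /= /andP[r0 reta] <-].
move: reta; rewrite !lt_min => /andP[/andP[reta r1] rD].
have lr : ln r < 0 by apply: ln_lt0; rewrite r0.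
have lrD : ln r < - (2 * ln D / e).
  by rewrite -ltr_expR lnK ?posrE.
have E1 : 1 <= expR (- (t + e / 2) * ln r).
  rewrite -[leLHS]expR0 ler_expR mulNr oppr_ge0; apply: mulr_ge0_le0; lra.
have DE : 1 <= D * expR (- (t + e / 2) * ln r) by rewrite mulr_ege1.
have cov : covered (S r) (D * expR (- (t + e / 2) * ln r)).
  apply: (covered_sub (HC r _)) => //; first by rewrite r0.
  by rewrite ler_pM2r ?expR_gt0// le_max lexx.
apply: le_trans (box_ratio_le _ DE cov) _; first by rewrite r0.
rewrite -EFinD lee_fin ler_pdivrMr ?oppr_gt0//.
rewrite lnM ?posrE ?expR_gt0 ?(lt_le_trans _ D1)// expRK.
have : ln D * 2 <= e * - ln r.
  have := ltW lrD; rewrite -lerN2 opprK ler_pdivrMr// => h; lra.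
by move=> h; lra.
Qed.

Lemma limsup0_ge (R : realType) (g : R -> \bar R) (t : R) :
  (forall e eta : R, 0 < e -> 0 < eta -> exists2 d : R, 0 < d < eta &
     ((t - e)%:E <= g d)%E) -> (t%:E <= limsup0 g)%E.
Proof.
move=> H; apply: le_ereal_inf_tmp => _ [eta eta0 ->].
apply/lee_subgt0Pr => e e0; have [d dlt gd] := H e eta e0 eta0.
by apply: le_ereal_sup_tmp; exists (g d) => //; exists d.
Qed.

(** * The scales and the points of a level *)

Definition scale {R : realType} (m : nat) : R := 4^-1 ^+ (m.+1)`!.

Lemma scale_gt0 {R : realType} m : 0 < scale m :> R.
Proof. by rewrite exprn_gt0// invr_gt0. Qed.

Lemma scaleS {R : realType} m : scale m.+1 = scale m ^+ m.+2 :> R.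
Proof. by rewrite /scale factS mulnC exprM. Qed.

Lemma scale_le4 {R : realType} m : scale m <= 4^-1 :> R.
Proof.
rewrite /scale -[leRHS]expr1 ler_wiXn2l ?fact_gt0//; lra.
Qed.

Lemma scaleS_le {R : realType} m : scale m.+1 <= scale m / 4 :> R.
Proof.
have s0 := @scale_gt0 R m; have s4 := @scale_le4 R m.
rewrite scaleS exprS ler_pM2l//; apply: le_trans (s4).
by rewrite -[leRHS]expr1 ler_wiXn2l//; lra.
Qed.

Lemma scale_anti {R : realType} m n : (m <= n)%N -> scale n <= scale m :> R.
Proof.
move=> /subnK <-; elim: (n - m)%N => // k; apply: le_trans; rewrite addSn.
by have := @scaleS_le R (k + m); have := @scale_gt0 R (k + m); lra.
Qed.

Lemma ln_scale_lt0 {R : realType} m : ln (scale m) < 0 :> R.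
Proof. by apply: ln_lt0; rewrite scale_gt0/=; have := @scale_le4 R m; lra. Qed.

Lemma ln_scaleS {R : realType} m : ln (scale m.+1) = m.+2%:R * ln (scale m) :> R.
Proof. by rewrite scaleS lnXn ?scale_gt0// mulr_natl. Qed.

(** A crude linear decay, with [m] in place of the factorial; it suffices to reach any small scale
    and to bound an index by a logarithm. *)
Lemma ln_scale_le {R : realType} m : ln (scale m) <= - (m%:R / 2) :> R.
Proof.
have l4 : ln 4^-1 <= - (2^-1) :> R.
  have := @le_ln1Dx R (4^-1 - 1); rewrite [1 + _]addrC subrK => h.
  by apply: le_trans (h _) _; lra.
have mF : m%:R <= ((m.+1)`!)%:R :> R by rewrite ler_nat ltnW// fact_geq.
rewrite lnXn// -[_ *+ (m.+1)`!]mulr_natl; apply: (@le_trans _ _ ((m.+1)`!%:R * - 2^-1)).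
  by rewrite ler_wpM2l.
by rewrite mulrN lerN2 ler_wpM2r.
Qed.

Lemma scale_lt_ex {R : realType} (r : R) : 0 < r -> exists n, scale n < r.
Proof.
move=> r0; exists (Num.bound (2 * `|ln r|)).
rewrite -[ltRHS]lnK ?posrE// -[ltLHS]lnK ?posrE ?scale_gt0// ltr_expR.
apply: le_lt_trans (ln_scale_le _) _.
have := archi_boundP (mulr_ge0 (ler0n R 2) (normr_ge0 (ln r))).
by have := ler_norm (- ln r); rewrite normrN; lra.
Qed.

(** The power [d_m^(b/a)]. Real powers are written with [expR] and [ln], so that comparing them
    becomes comparing exponents. *)
Definition fine_gap (R : realType) (a b : R) m : R :=
  expR (b / a * ln (scale m.+1)).

(** Truncation plus one makes [e_m d_m^(1-b)] a lower bound without loss, and costs at most one in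
    the upper bound. *)
Definition clusters (R : realType) (b : R) m : nat :=
  (Num.trunc (scale m * expR ((1 - b) * ln (scale m.+1)))).+1.

(** This is [e_m / d_m] exactly, because [(m+2)! - (m+1)! = (m+1) (m+1)!]. *)
Definition cluster_size m : nat := 4 ^ (m.+1 * (m.+1)`!).

Lemma cluster_sizeE {R : realType} m :
  (cluster_size m)%:R * scale m.+1 = scale m :> R.
Proof.
rewrite /cluster_size /scale [(m.+2)`!]factS [(m.+2 * _)%N]mulSn exprD natrX mulrCA.
by rewrite -exprMn divff// expr1n mulr1.
Qed.

Lemma cluster_size_expR {R : realType} m :
  (cluster_size m)%:R = scale m * expR (- ln (scale m.+1)) :> R.
Proof.
rewrite expRN lnK ?posrE ?scale_gt0//.
by rewrite -(@cluster_sizeE R m) mulfK// gt_eqF// scale_gt0.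
Qed.

Lemma fine_gap_gt0 (R : realType) (a b : R) m : 0 < fine_gap a b m.
Proof. exact: expR_gt0. Qed.

Lemma fine_gap_le (R : realType) (a b : R) m : 0 < a -> 2 * a <= b ->
  fine_gap a b m <= scale m.+1 ^+ 2.
Proof.
move=> a0 ab; rewrite -[scale _]lnK ?posrE ?scale_gt0// -expRM_natl ler_expR.
apply: ler_wnM2r; first exact/ltW/ln_scale_lt0.
by rewrite ler_pdivlMr.
Qed.

(** As [2a <= b], the gap is at most [d_m^2], so a cluster has width at most [e_m d_m]. Clusters
    spaced by [d_m] are therefore well apart. *)
Lemma cluster_width (R : realType) (a b : R) m : 0 < a -> 2 * a <= b ->
  (cluster_size m)%:R * fine_gap a b m <= scale m.+1 / 4.
Proof.
move=> a0 ab; apply: (@le_trans _ _ (scale m * scale m.+1)).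
  rewrite -(@cluster_sizeE R m) -mulrA -expr2.
  by rewrite ler_wpM2l// fine_gap_le.
by rewrite mulrC ler_pM2l ?scale_gt0// scale_le4.
Qed.

Lemma clusters_ge (R : realType) (b : R) m :
  scale m * expR ((1 - b) * ln (scale m.+1)) <= (clusters b m)%:R.
Proof.
by have /andP[_ /ltW] := truncn_itv
  (mulr_ge0 (ltW (@scale_gt0 R m)) (expR_ge0 ((1 - b) * ln (scale m.+1)))).
Qed.

Lemma clusters_le (R : realType) (b : R) m :
  (clusters b m)%:R <= scale m * expR ((1 - b) * ln (scale m.+1)) + 1.
Proof.
have /andP[h _] := truncn_itv
  (mulr_ge0 (ltW (@scale_gt0 R m)) (expR_ge0 ((1 - b) * ln (scale m.+1)))).
by rewrite /clusters -natr1 lerD2r.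
Qed.

Lemma clusters_le2 (R : realType) (b : R) m : 1 <= b ->
  (clusters b m)%:R <= 2 * expR ((1 - b) * ln (scale m.+1)) :> R.
Proof.
move=> b1; apply: le_trans (clusters_le b m) _.
have l0 := @ln_scale_lt0 R m.+1.
have : 1 <= expR ((1 - b) * ln (scale m.+1)).
  by rewrite -[leLHS]expR0 ler_expR; nra.
by have := @scale_le4 R m; have := @scale_gt0 R m; nra.
Qed.

(** The width is at most [e_m d_m^(2-b) + d_m], and [d_m^(2-b) <= 1] when [b <= 2]; hence level [m]
    stays within [[e_m, 3 e_m]]. *)
Lemma level_width (R : realType) (b : R) m : b <= 2 ->
  (clusters b m)%:R * (scale m.+1 : R) <= 2 * scale m :> R.
Proof.
move=> b2; have s0 := @scale_gt0 R m; have d0 := @scale_gt0 R m.+1.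
have l0 := @ln_scale_lt0 R m.+1.
have h := clusters_le b m; rewrite -(ler_pM2r d0) in h; apply: le_trans h _.
rewrite mulrDl mul1r -mulrA -{2}[scale m.+1]lnK ?posrE// -expRD.
have : expR ((1 - b) * ln (scale m.+1) + ln (scale m.+1)) <= 1 :> R.
  by rewrite -[leRHS]expR0 ler_expR; nra.
by have := @scaleS_le R m; nra.
Qed.

Lemma level_card_le (R : realType) (b : R) m : 1 <= b ->
  (clusters b m)%:R * (cluster_size m)%:R <= 2 * expR (- b * ln (scale m.+1)) :> R.
Proof.
move=> b1; rewrite [in leLHS]cluster_size_expR.
have h := clusters_le2 m b1; have s4 := @scale_le4 R m.
have E : expR (- b * ln (scale m.+1)) =
    expR ((1 - b) * ln (scale m.+1)) * expR (- ln (scale m.+1)) :> R.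
  by rewrite -expRD; congr expR; ring.
rewrite E [leRHS]mulrA; apply: ler_pM => //.
  by rewrite mulr_ge0// ltW// ?scale_gt0// expR_gt0.
by rewrite ger_pMl ?expR_gt0//; lra.
Qed.

(** One factor [e_m] comes from the number of clusters and one from their size; both are negligible,
    [ln d_m] being [m + 2] times [ln e_m]. *)
Lemma level_card_ge (R : realType) (b : R) m :
  scale m ^+ 2 * expR (- b * ln (scale m.+1)) <=
  (clusters b m)%:R * (cluster_size m)%:R.
Proof.
have h := clusters_ge b m; rewrite [in leRHS]cluster_size_expR.
have E : expR (- b * ln (scale m.+1)) =
    expR ((1 - b) * ln (scale m.+1)) * expR (- ln (scale m.+1)) :> R.
  by rewrite -expRD; congr expR; ring.
rewrite E expr2 mulrACA ler_pM2r//.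
by rewrite mulr_gt0 ?scale_gt0// expR_gt0.
Qed.

(** * Location and separation of the points *)

Definition pt (R : realType) (a b : R) m i j : R :=
  scale m + i%:R * scale m.+1 + j%:R * fine_gap a b m.

Lemma pt_bounds (R : realType) (a b : R) m i j : 0 < a -> 2 * a <= b -> b <= 2 ->
  (i < clusters b m)%N -> (j < cluster_size m)%N ->
  scale m <= pt a b m i j <= scale m + (clusters b m)%:R * scale m.+1.
Proof.
move=> a0 ab b2 iN jK; rewrite /pt.
have d0 := @scale_gt0 R m.+1; have g0 := fine_gap_gt0 a b m.
have w := cluster_width m a0 ab.
(* Even the last cluster starts a full spacing before the right end, which leaves room for its
   width. *)
have i1 : i%:R + 1 <= (clusters b m)%:R :> R by rewrite natr1 ler_nat.
have j1 : j%:R <= (cluster_size m)%:R :> R by rewrite ler_nat ltnW.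
have i0 : 0 <= i%:R :> R by []. have j0 : 0 <= j%:R :> R by [].
by apply/andP; split; nra.
Qed.

Lemma pt_le3 (R : realType) (a b : R) m i j : 0 < a -> 2 * a <= b -> b <= 2 ->
  (i < clusters b m)%N -> (j < cluster_size m)%N -> pt a b m i j <= 3 * scale m.
Proof.
move=> a0 ab b2 iN jK; have /andP[_ h] := pt_bounds a0 ab b2 iN jK.
by have := level_width m b2; lra.
Qed.

Lemma fine_gap_le_scale (R : realType) (a b : R) m : 0 < a -> 2 * a <= b ->
  fine_gap a b m <= scale m.+1 / 4.
Proof.
move=> a0 ab; apply: le_trans (fine_gap_le m a0 ab) _.
by rewrite expr2 ler_pM2l ?scale_gt0// scale_le4.
Qed.

(** Later levels lie below [3 e_(m+1) <= (3/4) e_m], while level [m] starts at [e_m]. *)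
Lemma pt_gap_lt (R : realType) (a b : R) m i j m' i' j' :
  0 < a -> 2 * a <= b -> b <= 2 ->
  (i < clusters b m)%N -> (j < cluster_size m)%N ->
  (i' < clusters b m')%N -> (j' < cluster_size m')%N ->
  (m < m')%N -> scale m / 4 <= pt a b m i j - pt a b m' i' j'.
Proof.
move=> a0 ab b2 iN jK iN' jK' mm'.
have /andP[h _] := pt_bounds a0 ab b2 iN jK.
have h' := pt_le3 a0 ab b2 iN' jK'.
by have := @scale_anti R _ _ mm'; have := @scaleS_le R m; lra.
Qed.

Lemma natr_dist_ge1 (R : realType) (i j : nat) : i != j ->
  1 <= `|i%:R - j%:R| :> R.
Proof.
case: ltngtP => // ij _.
  rewrite ler0_norm; last by rewrite subr_le0 ler_nat ltnW.
  by rewrite opprB lerBrDl natr1 ler_nat.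
rewrite ger0_norm; last by rewrite subr_ge0 ler_nat ltnW.
by rewrite lerBrDl natr1 ler_nat.
Qed.

Lemma pt_gap_same (R : realType) (a b : R) m i j i' j' :
  0 < a -> 2 * a <= b ->
  (j < cluster_size m)%N -> (j' < cluster_size m)%N ->
  (i, j) != (i', j') -> fine_gap a b m <= `|pt a b m i j - pt a b m i' j'|.
Proof.
move=> a0 ab jK jK' ne.
have d0 := @scale_gt0 R m.+1; have g0 := fine_gap_gt0 a b m.
have -> : pt a b m i j - pt a b m i' j' =
    (i%:R - i'%:R) * scale m.+1 + (j%:R - j'%:R) * fine_gap a b m.
  by rewrite /pt; ring.
case: (eqVneq i i') ne => [->|ii' _].
  rewrite xpair_eqE eqxx /= => /(@natr_dist_ge1 R) h.
  by rewrite subrr mul0r add0r normrM (gtr0_norm g0) ler_peMl// ltW.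
have h := @natr_dist_ge1 R _ _ ii'.
have w := cluster_width m a0 ab; have w' := fine_gap_le_scale m a0 ab.
have jj : `|(j%:R - j'%:R) * fine_gap a b m| <= scale m.+1 / 4.
  apply: le_trans w; rewrite normrM (gtr0_norm g0) ler_pM2r//.
  have jR : j%:R <= (cluster_size m)%:R :> R by rewrite ler_nat ltnW.
  have jR' : j'%:R <= (cluster_size m)%:R :> R by rewrite ler_nat ltnW.
  have j0 : 0 <= j%:R :> R by []. have j0' : 0 <= j'%:R :> R by [].
  by rewrite ler_norml; apply/andP; split; lra.
have := lerB_normD ((i%:R - i'%:R) * scale m.+1) ((j%:R - j'%:R) * fine_gap a b m).
rewrite normrM (gtr0_norm d0) => H; nra.
Qed.

(** The gap is that of the first point, even when the second lies in a finer level. So each point is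
    isolated at a distance fixed by its own level. *)
Lemma pt_gap (R : realType) (a b : R) m i j m' i' j' :
  0 < a -> 2 * a <= b -> b <= 2 ->
  (i < clusters b m)%N -> (j < cluster_size m)%N ->
  (i' < clusters b m')%N -> (j' < cluster_size m')%N ->
  (m, i, j) != (m', i', j') ->
  fine_gap a b m <= `|pt a b m i j - pt a b m' i' j'|.
Proof.
move=> a0 ab b2 iN jK iN' jK' ne.
have w := fine_gap_le_scale m a0 ab; have s := @scaleS_le R m.
have s0 := @scale_gt0 R m; have d0 := @scale_gt0 R m.+1.
case: (ltngtP m m') => [mm'|mm'|E].
- have := pt_gap_lt a0 ab b2 iN jK iN' jK' mm'.
  by have := ler_norm (pt a b m i j - pt a b m' i' j'); lra.
- have := pt_gap_lt a0 ab b2 iN' jK' iN jK mm'.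
  have := ler_norm (pt a b m' i' j' - pt a b m i j); rewrite distrC.
  by have := @scale_anti R _ _ (ltnW mm'); lra.
by subst m'; apply: pt_gap_same => //; apply: contraNneq ne => -[-> ->].
Qed.

(** * The set and its box dimension *)

Definition level (R : realType) (a b : R) m : set R :=
  [set x | exists i j, [/\ (i < clusters b m)%N, (j < cluster_size m)%N &
    x = pt a b m i j]].

Definition witness_set (R : realType) (a b : R) : set R :=
  [set x | x = 0 \/ exists m, level a b m x].

Definition grid1 (R : realType) (A : set R) (r : R) : set int :=
  [set k | exists2 x, A x & Num.floor (x / r) = k].

Lemma level_bounds (R : realType) (a b : R) m x :
  0 < a -> 2 * a <= b -> b <= 2 -> level a b m x ->
  scale m <= x <= 3 * scale m.
Proof.
move=> a0 ab b2 [i [j [iN jK ->]]].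
by rewrite (pt_le3 a0 ab b2 iN jK); have /andP[-> _] := pt_bounds a0 ab b2 iN jK.
Qed.

(** The cut behind compactness and all upper bounds: finitely many points, and a short interval at
    [0] holding all the rest. *)
Lemma witness_set_split (R : realType) (a b : R) n x :
  0 < a -> 2 * a <= b -> b <= 2 -> witness_set a b x ->
  (exists2 m, (m < n)%N & level a b m x) \/ 0 <= x <= 3 * scale n.
Proof.
move=> a0 ab b2 [->|[m mx]].
  by right; rewrite lexx mulr_ge0// ltW// scale_gt0.
case: (ltnP m n) => mn; [by left; exists m|right].
have /andP[h1 h2] := level_bounds a0 ab b2 mx.
have := @scale_anti R _ _ mn; have := @scale_gt0 R m.
by move=> *; apply/andP; split; lra.
Qed.

Lemma covered_image_level (R : realType) (T : choiceType) (a b : R) m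
    (g : R -> T) :
  covered (g @` level a b m) ((clusters b m)%:R * (cluster_size m)%:R : R).
Proof.
exists [seq g (pt a b m i j) | i <- iota 0 (clusters b m),
                               j <- iota 0 (cluster_size m)]; split.
  move=> _ [_ [i [j [iN jK ->]]] <-]; apply/allpairsP.
  by exists (i, j); rewrite !mem_iota.
by rewrite size_allpairs !size_iota natrM.
Qed.

Lemma finite_level (R : realType) (a b : R) m : finite_set (level a b m).
Proof.
rewrite -(image_id (level a b m)).
exact: covered_finite (covered_image_level _ _ _ _).
Qed.

Lemma witness_set_itv (R : realType) (a b : R) : 0 < a -> 2 * a <= b -> b <= 2 ->
  witness_set a b `<=` `[0, 1]%classic.
Proof.
move=> a0 ab b2 x /(witness_set_split 0 a0 ab b2)[[]//|/andP[x0 x3]].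
by rewrite /= in_itv/= x0/=; have := @scale_le4 R 0; lra.
Qed.

Lemma witness_set_compact (R : realType) (a b : R) :
  0 < a -> 2 * a <= b -> b <= 2 -> compact (witness_set a b).
Proof.
move=> a0 ab b2.
apply: (subclosed_compact _ (@segment_compact R 0 1) (witness_set_itv a0 ab b2)).
have -> : witness_set a b = \bigcap_(n in [set: nat])
    (\bigcup_(m in `I_n) level a b m `|` `[0, 3 * scale n]%classic).
  apply/seteqP; split => x.
    move=> Xx n _; have [[m mn mx]|h] := witness_set_split n a0 ab b2 Xx.
      by left; exists m.
    by right; rewrite /= in_itv.
  (* A nonzero [x] escapes [[0, 3 e_n]] once [e_n] is below [|x| / 3], so at that [n] it must lie in
     a level. *)
  move=> H; have [->|x0] := eqVneq x 0; first by left.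
  have x3 : 0 < `|x| / 3 by rewrite divr_gt0 ?normr_gt0.
  have [n nx] := scale_lt_ex x3; right.
  case: (H n I) => [[m _ mx]|]; first by exists m.
  rewrite /= in_itv/= => /andP[xge xle].
  by move: nx; rewrite ger0_norm//; lra.
apply: closed_bigI => n _; apply: closedU; last exact: itv_closed.
apply: closed_bigcup => // m _.
apply: (accessible_finite_set_closed.1 _ _ (finite_level a b m)).
exact/hausdorff_accessible/Rhausdorff.
Qed.

(** * Counting at an arbitrary scale, and the upper bound [a] *)

Lemma first_scale_below (R : realType) (r : R) : 0 < r ->
  exists n, scale n.+1 < r /\ forall m, (m < n)%N -> r <= scale m.+1.
Proof.
move=> r0; have ex : exists n, scale n.+1 < r.
  have [n nr] := scale_lt_ex r0; exists n; apply: le_lt_trans nr.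
  exact: scale_anti.
exists (ex_minn ex); case: ex_minnP => n nr nmin; split=> // m mn.
by rewrite leNgt; apply/negP => /nmin; rewrite leqNgt mn.
Qed.

(** For [n > 0], [r] is at most [d_(n-1) <= exp(-n/2)], so [n <= -2 ln r]; then [x <= exp x] is
    applied to [x = -e ln r]. *)
Lemma first_scale_index_le (R : realType) (r e : R) n : 0 < r -> 0 < e ->
  (forall m, (m < n)%N -> r <= scale m.+1) ->
  n%:R <= 2 / e * expR (- e * ln r).
Proof.
move=> r0 e0 nr.
case: n nr => [|n] nr; first by rewrite mulr_ge0 ?expR_ge0// divr_ge0// ltW.
have rs := nr n (ltnSn n).
have lr : ln r <= - (n.+1%:R / 2).
  apply: le_trans (ln_scale_le _).
  by rewrite ler_ln ?posrE ?scale_gt0.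
have h := expR_ge1Dx (- e * ln r).
rewrite -ler_pdivrMl ?divr_gt0// invf_div; apply: le_trans h.
by nra.
Qed.

Lemma covered_grid1_itv (R : realType) (A : set R) (u v r : R) : 0 < r ->
  u <= v -> (forall x, A x -> u <= x <= v) ->
  covered (grid1 A r) ((v - u) / r + 2).
Proof.
move=> r0 uv Auv; apply: covered_sub (covered_floor_itv r0 uv) _ (lexx _).
by move=> k [x /Auv xuv <-]; exists x.
Qed.

(** The level has width at most [2 d_m^(2-b) <= 2 r^(2-b)]. Division by [r] gives half of the bound;
    the two extra cells fit in the other half, as [r^(1-b) >= 1]. *)
Lemma covered_grid1_level_coarse (R : realType) (a b r : R) m :
  0 < a -> 2 * a <= b -> 1 <= b -> b <= 2 -> scale m.+1 < r -> r < 1 ->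
  covered (grid1 (level a b m) r) (4 * expR ((1 - b) * ln r)).
Proof.
move=> a0 ab b1 b2 dr r1; have d0 := @scale_gt0 R m.+1.
have r0 := lt_trans d0 dr; have lr : ln r < 0 by apply: ln_lt0; rewrite r0.
have ldr : ln (scale m.+1) <= ln r by rewrite ler_ln ?posrE// ltW.
pose w : R := (clusters b m)%:R * scale m.+1.
have uv : scale m <= scale m + w by rewrite lerDl mulr_ge0// ltW.
have lv x : level a b m x -> scale m <= x <= scale m + w.
  by move=> [i [j [iN jK ->]]]; exact: pt_bounds.
apply: covered_sub (covered_grid1_itv r0 uv lv) _ _ => //.
have one : 1 <= expR ((1 - b) * ln r) by rewrite -[leLHS]expR0 ler_expR; nra.
rewrite [_ + w]addrC addrK; suff : w / r <= 2 * expR ((1 - b) * ln r) by lra.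
rewrite ler_pdivrMr// -mulrA -{2}(lnK (_ : r \is Num.pos)) ?posrE// -expRD.
apply: (@le_trans _ _ (2 * expR ((1 - b) * ln (scale m.+1)) * scale m.+1)).
  by rewrite /w ler_pM2r// clusters_le2.
rewrite -mulrA -{2}[scale m.+1](lnK (_ : _ \is Num.pos)) ?posrE// -expRD.
by rewrite ler_pM2l// ler_expR; nra.
Qed.

(** Three regimes: below the gap points are counted, between the gap and [d_m] each cluster is
    covered as an interval, and above [d_m] the whole level is. *)
Lemma covered_grid1_level (R : realType) (a b r : R) m :
  0 < a -> a <= 1 -> 2 * a <= b -> 1 <= b -> b <= a + 1 -> 0 < r < 1 ->
  covered (grid1 (level a b m) r) (6 * expR (- a * ln r)).
Proof.
move=> a0 a1 ab b1 ba /andP[r0 r1]; have b2 : b <= 2 by lra.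
have lr : ln r < 0 by apply: ln_lt0; rewrite r0.
have d0 := @scale_gt0 R m.+1; have l0 := @ln_scale_lt0 R m.+1.
set l := ln (scale m.+1) in l0.
have E0 := expR_gt0 (- a * ln r).
have g0 := fine_gap_gt0 a b m.
have bal : a * (b / a * l) = b * l by field; rewrite gt_eqF.
case: (leP r (fine_gap a b m)) => [rg|gr].
  have lrg : ln r <= b / a * l by rewrite -ler_expR lnK ?posrE.
  apply: covered_sub
    (covered_image_level a b m (fun x => Num.floor (x / r))) _ _.
    by move=> k [x xl <-]; exists x.
  apply: le_trans (level_card_le m b1) _.
  have : expR (- b * l) <= expR (- a * ln r).
    by rewrite ler_expR; move: lrg; rewrite -(ler_pM2l a0) bal; lra.
  by rewrite -/l; lra.
(* Above [d_m], the hypothesis [b <= a + 1] gives [r^(1-b) <= r^(-a)]. *)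
case: (leP r (scale m.+1)) => [rd|dr]; last first.
  apply: covered_sub (covered_grid1_level_coarse a0 ab b1 b2 dr r1) _ _ => //.
  have : expR ((1 - b) * ln r) <= expR (- a * ln r) by rewrite ler_expR; nra.
  by have := expR_gt0 ((1 - b) * ln r); lra.
have lrl : ln r <= l by rewrite ler_ln ?posrE.
have lgr : b / a * l <= ln r by rewrite -ler_expR lnK ?posrE// ltW.
pose K : R := (cluster_size m)%:R * fine_gap a b m.
have K0 : 0 <= K by rewrite mulr_ge0// ltW.
pose C i := grid1 [set x | pt a b m i 0 <= x <= pt a b m i 0 + K] r.
have cov i : (i < clusters b m)%N -> covered (C i) (K / r + 2).
  move=> _; have uv : pt a b m i 0 <= pt a b m i 0 + K by rewrite lerDl.
  have := @covered_grid1_itv R _ _ _ r r0 uv (fun x h => h).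
  by rewrite [X in X - _]addrC addrK.
apply: covered_sub (covered_bigcup cov) _ _.
  move=> k [_ [i [j [iN jK ->]]] <-]; exists i => //.
  exists (pt a b m i j) => //=; rewrite /pt mul0r addr0 lerDl lerD2l.
  by rewrite mulr_ge0 ?(ltW g0)// ler_pM2r// ler_nat ltnW.
rewrite mulrDr /K.
have h1 : (clusters b m)%:R * ((cluster_size m)%:R * fine_gap a b m / r) <=
    2 * expR (- a * ln r).
  rewrite -mulrA mulrA.
  (* With [g] the gap, [d_m^(-b) = g^(-a)], so this says [g^(1-a) <= r^(1-a)], true for [g < r] and
     [a <= 1]. *)
  have h : expR (- b * l) * (fine_gap a b m / r) <= expR (- a * ln r).
    rewrite -[r^-1](lnK (_ : _ \is Num.pos)) ?posrE ?invr_gt0// lnV ?posrE//.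
    rewrite /fine_gap -!expRD ler_expR -/l.
    by move: lgr bal; set t := b / a * l => lgr bal; nra.
  have := ler_wpM2r (divr_ge0 (ltW g0) (ltW r0)) (level_card_le m b1).
  by rewrite -/l; lra.
have h2 : (clusters b m)%:R <= 2 * expR (- a * ln r).
  apply: le_trans (clusters_le2 m b1) _; rewrite ler_pM2l// ler_expR -/l.
  by nra.
by lra.
Qed.

Lemma upper_box_dim1_witness_le (R : realType) (a b : R) :
  0 < a -> a <= 1 -> 2 * a <= b -> 1 <= b -> b <= a + 1 ->
  (upper_box_dim1 (witness_set a b) <= a%:E)%E.
Proof.
move=> a0 a1 ab b1 ba; have b2 : b <= 2 by lra.
apply: limsup0_le => [|e e0]; first exact: ltW.
(* Each of the levels [0] to [n] costs [6 r^(-a)]: [12 / e] pays for [n] of them through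
   [n <= (2 / e) r^(-e)], and [11] is one more [6] plus [5] cells near [0]. *)
exists (12 / e + 11); exists 1; split=> // r r01; have /andP[r0 r1] := r01.
have lr : ln r < 0 by apply: ln_lt0; rewrite r0.
have [n [nr nmin]] := first_scale_below r0.
have d0 := @scale_gt0 R n.+1.
have c1 := covered_bigcup (fun i (_ : (i < n.+1)%N) =>
  covered_grid1_level i a0 a1 ab b1 ba r01).
have uv : 0 <= 3 * scale n.+1 :> R by rewrite mulr_ge0// ltW.
have c2 := covered_grid1_itv r0 uv (fun x h => h).
apply: covered_sub (covered_setU c1 c2) _ _.
  move=> k [x /(witness_set_split n.+1 a0 ab b2)[[m mn mx]|xs] <-].
    by left; exists m => //; exists x.
  by right; exists x.
have h3 : (3 * scale n.+1 - 0) / r + 2 <= 5.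
  suff : (3 * scale n.+1 - 0) / r <= 3 by lra.
  by rewrite ler_pdivrMr//; lra.
have hn := first_scale_index_le r0 e0 nmin.
have -> : - (a + e) * ln r = - e * ln r + - a * ln r by ring.
rewrite expRD; set A := expR (- e * ln r) in hn *; set B := expR (- a * ln r).
have A1 : 1 <= A by rewrite -[leLHS]expR0 ler_expR; nra.
have B1 : 1 <= B by rewrite -[leLHS]expR0 ler_expR; nra.
have AB : B <= A * B by rewrite ler_peMl; lra.
apply: (@le_trans _ _ ((n%:R + 1) * (6 * B) + 5)).
  by rewrite natr1 lerD2l.
have : n%:R * B <= 2 / e * (A * B) by rewrite mulrA ler_wpM2r//; lra.
by move=> h; rewrite mulrDl [12 / e](_ : _ = 6 * (2 / e)); [lra|ring].
Qed.

(** * Lower bounds from a single level *)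

Lemma uniq_level_image (R : realType) (T : eqType) (b : R) m
    (g : nat -> nat -> T) :
  (forall i j i' j', (i < clusters b m)%N -> (j < cluster_size m)%N ->
     (i' < clusters b m)%N -> (j' < cluster_size m)%N ->
     g i j = g i' j' -> (i, j) = (i', j')) ->
  uniq [seq g i j | i <- iota 0 (clusters b m), j <- iota 0 (cluster_size m)].
Proof.
move=> ginj; apply: allpairs_uniq; rewrite ?iota_uniq//.
move=> _ _ /allpairsP[[i j] [+ + ->]] /allpairsP[[i' j'] [+ + ->]].
by rewrite !mem_iota !add0n; exact: ginj.
Qed.

(** Serves both lower bounds: at scale [d_m^c] with all points of level [m] in distinct cells, the
    ratio is at least [b/c - 2/(c (m+2))]. The choice [c = b/a] yields [a], and [c = 1] yields
    [b]. *)
Lemma box_ratio_level_ge (R : realType) (T : choiceType) (b c e r : R) m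
    (S : set T) (g : nat -> nat -> T) :
  0 < c -> r = expR (c * ln (scale m.+1)) -> 2 / (c * m.+2%:R) <= e ->
  (forall i j, (i < clusters b m)%N -> (j < cluster_size m)%N -> S (g i j)) ->
  (forall i j i' j', (i < clusters b m)%N -> (j < cluster_size m)%N ->
     (i' < clusters b m)%N -> (j' < cluster_size m)%N ->
     g i j = g i' j' -> (i, j) = (i', j')) ->
  ((b / c - e)%:E <= box_ratio (ecount R S) r)%E.
Proof.
move=> c0 rE ce Sg ginj; have l0 := @ln_scale_lt0 R m.+1.
have s0 := @scale_gt0 R m.
have lc : c * ln (scale m.+1) < 0 :> R by nra.
have r01 : 0 < r < 1.
  by rewrite rE expR_gt0 -[ltRHS]expR0 ltr_expR.
have M0 : 0 < scale m ^+ 2 * expR (- b * ln (scale m.+1)) :> R.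
  by rewrite mulr_gt0 ?expR_gt0 ?exprn_gt0.
apply: le_trans (box_ratio_ge r01 M0 (uniq_level_image ginj) _ _).
- rewrite lee_fin rE expRK lnM ?posrE ?expR_gt0 ?exprn_gt0// expRK lnXn//.
  rewrite ler_pdivlMr ?oppr_gt0// ln_scaleS.
  have m2 : 0 < m.+2%:R :> R by [].
  have ls : ln (scale m) < 0 :> R := ln_scale_lt0 m.
  move: ce; rewrite ler_pdivrMr ?mulr_gt0// => ce.
  set L := ln (scale m) in ls *; set q := m.+2%:R in ce m2 *.
  have -> : (b / c - e) * - (c * (q * L)) = - b * (q * L) + e * (c * q) * L.
    by clear -c0; field; exact: lt0r_neq0.
  by nra.
- by move=> x /allpairsP[[i j] [+ + ->]]; rewrite !mem_iota; exact: Sg.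
by rewrite size_allpairs !size_iota natrM level_card_ge.
Qed.

Lemma floor_div_neq (R : realType) (x y r : R) : 0 < r -> r <= `|x - y| ->
  Num.floor (x / r) <> Num.floor (y / r).
Proof.
move=> r0 rxy E; have /andP[x1 x2] := floor_itv (x / r).
have /andP[y1 y2] := floor_itv (y / r); move: x1 x2; rewrite E => x1 x2.
have : `|x / r - y / r| < 1.
  by move: x2 y2; rewrite intrD => x2 y2; rewrite ltr_norml; apply/andP; split; lra.
have ri : 0 < r^-1 by rewrite invr_gt0.
rewrite -mulrBl normrM (gtr0_norm ri) ltr_pdivrMr// mul1r.
by rewrite ltNge rxy.
Qed.

Lemma large_index (R : realType) (c e eta : R) : 0 < c -> 0 < e -> 0 < eta ->
  exists m, 2 / (c * m.+2%:R) <= e /\ scale m < eta.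
Proof.
move=> c0 e0 eta0; have [n neta] := scale_lt_ex eta0.
exists (maxn n (Num.bound (2 / (c * e)))); split; last first.
  by apply: le_lt_trans neta; apply: scale_anti; exact: leq_maxl.
set m := maxn _ _.
have hm : 2 / (c * e) <= m.+2%:R.
  have h0 : 0 <= 2 / (c * e) by rewrite divr_ge0// mulr_ge0// ltW.
  apply: ltW; apply: lt_le_trans (archi_boundP h0) _.
  by rewrite ler_nat; do 2 apply: leqW; exact: leq_maxr.
move: hm; rewrite ler_pdivrMr ?mulr_gt0// => hm.
by rewrite ler_pdivrMr ?mulr_gt0//; nra.
Qed.

Lemma upper_box_dim1_witness_ge (R : realType) (a b : R) :
  0 < a -> 2 * a <= b -> b <= 2 ->
  (a%:E <= upper_box_dim1 (witness_set a b))%E.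
Proof.
move=> a0 ab b2; have b0 : 0 < b by lra.
apply: limsup0_ge => e eta e0 eta0.
have ba0 : 0 < b / a by rewrite divr_gt0.
have [m [me meta]] := large_index ba0 e0 eta0.
exists (fine_gap a b m).
  rewrite fine_gap_gt0/=; apply: le_lt_trans meta.
  have := fine_gap_le_scale m a0 ab; have := @scaleS_le R m.
  by have := @scale_gt0 R m; have := @scale_gt0 R m.+1; lra.
have {1}-> : a = b / (b / a) by field; rewrite !gt_eqF.
apply: (@box_ratio_level_ge _ _ b (b / a) e _ m _
  (fun i j => Num.floor (pt a b m i j / fine_gap a b m))) => //.
  move=> i j iN jK; exists (pt a b m i j) => //.
  by right; exists m, i, j.
move=> i j i' j' iN jK iN' jK' E; apply/eqP; apply: contra_eqT E => ne.
by apply/eqP/floor_div_neq; [exact: fine_gap_gt0|exact: pt_gap_same].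
Qed.

(** * Graphs over the set *)

(* The value [0] at the point [0] comes from the default value of [xget]. *)
Definition wave (R : realType) (a b x : R) : R :=
  let t := xget (0, 0, 0)%N [set t : nat * nat * nat |
    [/\ (t.1.2 < clusters b t.1.1)%N, (t.2 < cluster_size t.1.1)%N &
      x = pt a b t.1.1 t.1.2 t.2]] in
  t.2%:R * scale t.1.1.+1.

(** By [pt_gap] a point determines its three indices, so the choice made by [xget] is forced. *)
Lemma wave_pt (R : realType) (a b : R) m i j :
  0 < a -> 2 * a <= b -> b <= 2 ->
  (i < clusters b m)%N -> (j < cluster_size m)%N ->
  wave a b (pt a b m i j) = j%:R * scale m.+1.
Proof.
move=> a0 ab b2 iN jK; rewrite /wave (@xget_unique _ _ _ (m, i, j)) //.
move=> [[m' i'] j'] [/= iN' jK' E]; apply/eqP; apply: contraT => ne.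
have := pt_gap a0 ab b2 iN' jK' iN jK ne.
by rewrite E subrr normr0 leNgt fine_gap_gt0.
Qed.

Lemma wave0 (R : realType) (a b : R) : 0 < a -> 2 * a <= b -> b <= 2 ->
  wave a b 0 = 0.
Proof.
move=> a0 ab b2; rewrite /wave xgetPN ?mul0r// => -[[m i] j] [/= iN jK E].
have /andP[] := pt_bounds a0 ab b2 iN jK.
by rewrite -E leNgt scale_gt0.
Qed.

Lemma wave_level_bounds (R : realType) (a b : R) m x :
  0 < a -> 2 * a <= b -> b <= 2 -> level a b m x ->
  0 <= wave a b x <= scale m.
Proof.
move=> a0 ab b2 [i [j [iN jK ->]]]; rewrite wave_pt//.
have d0 := @scale_gt0 R m.+1; rewrite mulr_ge0 ?(ltW d0)//=.
by rewrite -(@cluster_sizeE R m) ler_pM2r// ler_nat ltnW.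
Qed.

Lemma level_isolated (R : realType) (a b : R) m x y :
  0 < a -> 2 * a <= b -> b <= 2 -> level a b m x -> witness_set a b y ->
  `|x - y| < fine_gap a b m -> x = y.
Proof.
move=> a0 ab b2 xm Xy xy; have /andP[xs _] := level_bounds a0 ab b2 xm.
case: Xy xy => [->|[m' [i' [j' [iN' jK' ->]]]]].
  rewrite subr0 ger0_norm ?(le_trans _ xs) ?ltW ?scale_gt0// => xy.
  have := fine_gap_le_scale m a0 ab; have := @scaleS_le R m.
  by have := @scale_gt0 R m; lra.
case: xm => i [j [iN jK ->]].
case: (eqVneq (m, i, j) (m', i', j')) => [[-> -> ->]//|ne].
by rewrite ltNge pt_gap.
Qed.

Lemma fine_gap_anti (R : realType) (a b : R) m n : 0 < a -> 0 < b ->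
  (m <= n)%N -> fine_gap a b n <= fine_gap a b m.
Proof.
move=> a0 b0 mn; rewrite ler_expR ler_pM2l ?divr_gt0// ler_ln ?posrE ?scale_gt0//.
exact: scale_anti.
Qed.

(** With [e_n < e], the gap of level [n] serves as modulus: points of levels before [n] have no
    other point of the set that close, and all remaining values lie in [[0, e_n]]. *)
Lemma wave_unif_cont (R : realType) (a b : R) : 0 < a -> 2 * a <= b -> b <= 2 ->
  unif_cont_on (witness_set a b) (wave a b).
Proof.
move=> a0 ab b2 e e0; have [n ne] := scale_lt_ex e0.
have b0 : 0 < b by lra.
exists (fine_gap a b n) => [|x y Xx Xy xy]; first exact: fine_gap_gt0.
have dich z : witness_set a b z ->
    (exists2 m, (m < n)%N & level a b m z) \/ 0 <= wave a b z <= scale n.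
  move=> [->|[m mz]]; first by right; rewrite wave0// lexx ltW// scale_gt0.
  case: (ltnP m n) => mn; [by left; exists m|right].
  have /andP[-> h] := wave_level_bounds a0 ab b2 mz.
  by apply: le_trans h _; exact: scale_anti.
have same u v : witness_set a b v -> (exists2 m, (m < n)%N & level a b m u) ->
    `|u - v| < fine_gap a b n -> u = v.
  move=> Xv [m mn mu] uv; apply: (level_isolated a0 ab b2 mu Xv).
  by apply: lt_le_trans uv _; apply: fine_gap_anti => //; exact: ltnW.
case: (dich x Xx) => [hx|/andP[x1 x2]].
  by rewrite (same _ _ Xy hx xy) subrr normr0.
case: (dich y Xy) => [hy|/andP[y1 y2]].
  by rewrite -(same _ _ Xx hy) ?subrr ?normr0// distrC.
by rewrite ltr_norml; apply/andP; split; lra.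
Qed.

(** At scale [d_m] the row of a square is exactly [j]; for equal [j], points of different clusters
    are at least [d_m] apart, so the column separates the [i]. *)
Lemma upper_box_dim2_wave_ge (R : realType) (a b : R) :
  0 < a -> 2 * a <= b -> b <= 2 ->
  (b%:E <= upper_box_dim2 (graph_on (witness_set a b) (wave a b)))%E.
Proof.
move=> a0 ab b2; apply: limsup0_ge => e eta e0 eta0.
have [m [me meta]] := large_index ltr01 e0 eta0.
have d0 := @scale_gt0 R m.+1.
exists (scale m.+1).
  rewrite d0/=; apply: le_lt_trans meta; exact: scale_anti.
rewrite -[b in b - e]divr1.
apply: (@box_ratio_level_ge _ _ b 1 e _ m _ (fun i j =>
  (Num.floor (pt a b m i j / scale m.+1),
   Num.floor (wave a b (pt a b m i j) / scale m.+1)))) => //.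
- by rewrite mul1r lnK ?posrE.
- move=> i j iN jK; exists (pt a b m i j, wave a b (pt a b m i j)) => //.
  by exists (pt a b m i j) => //; right; exists m, i, j.
move=> i j i' j' iN jK iN' jK' [E1 E2].
have floor_nat k : Num.floor (k%:R : R) = k%:Z.
  by rewrite -[k%:R]/((k%:Z)%:~R) intrKfloor.
have jj' : j = j'.
  by move: E2; rewrite !wave_pt// !mulfK ?gt_eqF// !floor_nat => -[].
rewrite -jj' in E1 *; congr pair; apply/eqP; apply: contraPT E1 => ne.
apply: floor_div_neq => //.
have -> : pt a b m i j - pt a b m i' j = (i%:R - i'%:R) * scale m.+1.
  by rewrite /pt; ring.
by rewrite normrM (gtr0_norm d0) ler_peMl ?natr_dist_ge1// ltW.
Qed.

(** * Upper bound for all uniformly continuous functions *)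

Lemma covered_grid2_level_fine (R : realType) (a b r : R) (f : R -> R) m :
  1 <= b -> 0 < r -> r <= scale m.+1 ->
  covered [set (Num.floor (x / r), Num.floor (f x / r)) | x in level a b m]
    (2 * expR (- b * ln r)).
Proof.
move=> b1 r0 rd; apply: (covered_sub (covered_image_level a b m
  (fun x => (Num.floor (x / r), Num.floor (f x / r))))) => //.
apply: le_trans (level_card_le m b1) _; rewrite ler_pM2l// ler_expR.
have : ln r <= ln (scale m.+1) by rewrite ler_ln ?posrE ?scale_gt0.
by nra.
Qed.

(** Uniform continuity enters as a bound on [f]: near [0] it stays within [1] of [f 0], so a column
    there meets at most [4 / r] squares. *)
Lemma upper_box_dim2_graph_le (R : realType) (a b : R) (f : R -> R) :
  0 < a -> 2 * a <= b -> 1 <= b -> b <= 2 ->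
  unif_cont_on (witness_set a b) f ->
  (upper_box_dim2 (graph_on (witness_set a b) f) <= b%:E)%E.
Proof.
move=> a0 ab b1 b2 fc; apply: limsup0_le => [|e e0]; first lra.
have [del del0 fdel] := fc 1 ltr01.
have del3 : 0 < del / 3 by rewrite divr_gt0.
have [M Mdel] := scale_lt_ex del3.
(* The [n] levels before [n] cost [2 r^(-b)] each, hence [4 / e]; level [n] costs [4 * 4] and the
   rest [5 * 4], in sum [36]. Taking [r < e_M] forces [M <= n], so level [n] already lies where [f]
   is controlled. *)
exists (4 / e + 36); exists (scale M); split; first exact: scale_gt0.
move=> r /andP[r0 rM]; have r1 : r < 1 by have := @scale_le4 R M; lra.
have lr : ln r < 0 by apply: ln_lt0; rewrite r0.
have [n [nr nmin]] := first_scale_below r0.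
have Mn : (M <= n)%N.
  rewrite leqNgt; apply/negP => /(@scale_anti R) h.
  by have := lt_trans nr rM; rewrite ltNge h.
have d0 := @scale_gt0 R n.+1.
have near0 x : witness_set a b x -> 0 <= x <= 3 * scale M ->
    f 0 - 1 <= f x <= f 0 + 1.
  move=> Xx /andP[x0 x3].
  have := fdel x 0 Xx (or_introl erefl); rewrite subr0 ger0_norm// => h.
  have {}h : `|f x - f 0| < 1 by apply: h; lra.
  by move: h; rewrite ltr_norml => /andP[h1 h2]; apply/andP; split; lra.
pose V := grid1 [set y | f 0 - 1 <= y <= f 0 + 1] r.
have rV : r^-1 = expR (- ln r) by rewrite expRN lnK ?posrE.
have cV : covered V (4 * expR (- ln r)).
  have uv : f 0 - 1 <= f 0 + 1 by lra.
  apply: covered_sub (covered_grid1_itv r0 uv (fun y h => h)) _ _ => //.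
  have : 1 <= r^-1 by rewrite invf_ge1// ltW.
  by rewrite -rV; lra.
have c1 := covered_bigcup (fun m (mn : (m < n)%N) =>
  covered_grid2_level_fine a f b1 r0 (nmin m mn)).
have c2 := covered_setX (covered_grid1_level_coarse a0 ab b1 b2 nr r1) cV.
have uv : 0 <= 3 * scale n.+1 :> R by rewrite mulr_ge0// ltW.
have c3 := covered_setX (covered_grid1_itv r0 uv (fun x h => h)) cV.
apply: covered_sub (covered_setU (covered_setU c1 c2) c3) _ _.
  move=> _ [_ [x Xx <-] <-] /=.
  have := witness_set_split n a0 ab b2 Xx => -[[m mn mx]|xn].
    by left; left; exists m => //; exists x.
  have fx : f 0 - 1 <= f x <= f 0 + 1.
    apply: near0 => //; move: xn => /andP[-> /= xn]; apply: le_trans xn _.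
    by rewrite ler_pM2l// scale_anti.
  (* A second cut, one index later, separates level [n] from [[0, 3 d_n]]. *)
  have [[m mn mx]|xn1] := witness_set_split n.+1 a0 ab b2 Xx; last first.
    by right; split; [exists x | exists (f x)].
  move: mn; rewrite ltnS leq_eqVlt => /orP[/eqP E|mn].
    by subst m; left; right; split; [exists x | exists (f x)].
  by left; left; exists m => //; exists x.
have h3 : (3 * scale n.+1 - 0) / r + 2 <= 5.
  suff : (3 * scale n.+1 - 0) / r <= 3 by lra.
  by rewrite ler_pdivrMr//; lra.
have hn := first_scale_index_le r0 e0 nmin.
have -> : - (b + e) * ln r = - e * ln r + - b * ln r by ring.
have B2 : expR ((1 - b) * ln r) * expR (- ln r) = expR (- b * ln r).
  by rewrite -expRD; congr expR; ring.
have B3 : expR (- ln r) <= expR (- b * ln r) by rewrite ler_expR; nra.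
have E0 := expR_gt0 (- ln r).
rewrite expRD; set A := expR (- e * ln r) in hn *.
set B := expR (- b * ln r) in B2 B3 *.
have A1 : 1 <= A by rewrite -[leLHS]expR0 ler_expR; nra.
have B0 : 0 < B := expR_gt0 _.
have AB : B <= A * B by rewrite ler_peMl//; exact: ltW.
have h4 : ((3 * scale n.+1 - 0) / r + 2) * (4 * expR (- ln r)) <= 20 * B by nra.
have : n%:R * B <= 2 / e * (A * B) by rewrite mulrA ler_wpM2r// ltW.
have -> : 4 * expR ((1 - b) * ln r) * (4 * expR (- ln r)) = 16 * B.
  by rewrite -B2; ring.
by move=> h; rewrite mulrDl [4 / e](_ : _ = 2 * (2 / e)); [lra|ring].
Qed.

Theorem theorem3 (R : realType) (a b : R) :
  0 < a -> a <= 1 -> Num.max (2 * a) 1 <= b -> b <= a + 1 ->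
  exists X : set R, [/\ compact X, X `<=` `[0, 1]%classic,
    upper_box_dim1 X = a%:E & upper_graph_box_dim X = b%:E].
Proof.
move=> a0 a1; rewrite ge_max => /andP[ab b1] ba; have b2 : b <= 2 by lra.
exists (witness_set a b); split.
- exact: witness_set_compact.
- exact: witness_set_itv.
- apply/eqP; rewrite eq_le upper_box_dim1_witness_le//=.
  exact: upper_box_dim1_witness_ge.
apply/eqP; rewrite eq_le; apply/andP; split.
  by apply: ge_ereal_sup => _ [f fc <-]; exact: upper_box_dim2_graph_le.
apply: le_ereal_sup_tmp.
exists (upper_box_dim2 (graph_on (witness_set a b) (wave a b))).
  by exists (wave a b) => //; exact: wave_unif_cont.
exact: upper_box_dim2_wave_ge.
Qed.
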